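(* Let $k\ge 2$, let $a,b$ be indeterminates, and let $p_k(x;a,b)=1-ax-bx^k$. If $H(x)=\frac{1}{p_k(x;a,b)}*\frac{1}{p_k(x;a,b)}=H_1(x)/H_2(x)$ with $H_1,H_2$ coprime in $\mathbb{Q}(a,b)[x]$, then \[ H_2(x)=p_k(\sqrt{x};a,b)\,p_k(-\sqrt{x};a,b)\,f_{k-1}(x;a,-b). \]
   Context: The Hadamard product of $\sum a_nx^n$ and $\sum b_nx^n$ is $\sum a_nb_nx^n$. An odd composition is a finite sequence of odd positive integers; $\mathrm{OC}_{\le N}$ is the set of odd compositions of integers in $\{0,\ldots,N\}$ (including the empty one); $\ell(\alpha)$ is the number of parts. $\sigma_N$ is the permutation of $\{1,\ldots,N\}$ with $\sigma_N(i)=i/2$ for $i$ even and $\sigma_N(i)=N+(1-i)/2$ for $i$ odd, and $S_N(\alpha)=\sum_{i=1}^{\ell(\alpha)}\sigma_N(\alpha_1+\cdots+\alpha_i)$. For a positive integer $N$, \[ f_N(x;a,b)=\sum_{\alpha\in\mathrm{OC}_{\le N}}(-1)^{\lfloor(\ell(\alpha)+1)/2\rfloor}a^{\mathrm{rem}(\alpha)}b^{\ell(\alpha)}x^{S_N(\alpha)}, \] where $\mathrm{rem}(\alpha)$ is the remainder of $2S_N(\alpha)$ upon division by $N+1$; $f_{k-1}(x;a,-b)$ is this with $b$ replaced by $-b$.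
   Formalization: A coprime pair H_1, H_2 is only determined up to a common nonzero constant of Q(a,b), so the equality for H_2 is proved up to such a constant in general, and exactly when H_2(0)=1. *)

(* Defs.v *)
From HB Require Import structures.
From mathcomp Require Import all_boot all_order all_algebra.
From mathcomp Require Import mpoly.

Set Implicit Arguments.
Unset Strict Implicit.
Unset Printing Implicit Defensive.

Import GRing.Theory.
Local Open Scope ring_scope.

(* Formal power series in x, as coefficient sequences; equality of series is
   pointwise equality [=1]. *)
Definition fps (R : Type) := nat -> R.

Section PowerSeries.
Variable F : fieldType.

Definition fps_of_poly (p : {poly F}) : fps F := fun n => p`_n.

Definition fps_mul (s t : fps F) : fps F :=
  fun n => \sum_(i < n.+1) s i * t (n - i)%N.

Definition hadamard (s t : fps F) : fps F := fun n => s n * t n.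

(* The first n coefficients of 1/s, obtained by solving s * t = 1 degree by
   degree. *)
Fixpoint fps_inv_seq (s : fps F) (n : nat) : seq F :=
  if n is m.+1 then
    let t := fps_inv_seq s m in
    rcons t ((s 0%N)^-1 * ((m == 0%N)%:R - \sum_(i < m) t`_i * s (m - i)%N))
  else [::].

Definition fps_inv (s : fps F) : fps F := fun n => (fps_inv_seq s n.+1)`_n.

Lemma size_fps_inv_seq s n : size (fps_inv_seq s n) = n.
Proof. by elim: n => //= n IHn; rewrite size_rcons IHn. Qed.

Lemma nth_fps_inv_seq s n i : (i < n)%N -> (fps_inv_seq s n)`_i = fps_inv s i.
Proof.
elim: n => // n IHn; rewrite ltnS leq_eqVlt => /predU1P[-> //|lt_in].
by rewrite /= nth_rcons size_fps_inv_seq lt_in IHn.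
Qed.

Lemma fps_mulV (s : fps F) :
  s 0%N != 0 -> fps_mul (fps_inv s) s =1 (fun n => (n == 0%N)%:R).
Proof.
move=> s0 n; rewrite /fps_mul big_ord_recr /= subnn.
rewrite {2}/fps_inv /= nth_rcons size_fps_inv_seq ltnn eqxx.
rewrite mulrAC mulVf // mul1r addrC.
rewrite [X in _ - X](eq_bigr (fun i : 'I_n => fps_inv s i * s (n - i)%N)).
  by rewrite subrK.
by move=> i _; rewrite nth_fps_inv_seq.
Qed.

(* s = P / Q in the field of formal Laurent series. *)
Definition fps_is_ratio (s : fps F) (P Q : {poly F}) : Prop :=
  Q != 0 /\ fps_mul (fps_of_poly Q) s =1 fps_of_poly P.

End PowerSeries.

(* An odd number is automatically positive. *)
Definition odd_composition (s : seq nat) : bool := all odd s.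

(* For odd i <= N, N + (1 - i)/2 = N - (i - 1)/2 without truncation. *)
Definition sigma (N i : nat) : nat :=
  if odd i then (N - (i - 1) %/ 2)%N else (i %/ 2)%N.

Definition S_ (N : nat) (s : seq nat) : nat :=
  (\sum_(1 <= i < (size s).+1) sigma N (sumn (take i s)))%N.

Definition rem_ (N : nat) (s : seq nat) : nat := ((2 * S_ N s) %% N.+1)%N.

Section Polynomials.
Variable R : comNzRingType.

(* A composition of an integer <= N has at most N parts, each at most N, so
   the compositions below, read in the finite type of sequences of length at
   most N over {0, ..., N}, are all the elements of OC_{<= N}. *)
Definition f_ (N : nat) (a b : R) : {poly R} :=
  \sum_(alpha : N.-bseq 'I_N.+1 |
         odd_composition (map val alpha) && (sumn (map val alpha) <= N)%N)
    let s := map val alpha in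
    ((-1) ^+ ((size s + 1) %/ 2) * a ^+ rem_ N s * b ^+ size s) *: 'X^(S_ N s).

Definition p_ (k : nat) (a b : R) : {poly R} := 1 - a *: 'X - b *: 'X^k.

End Polynomials.

(* The field Q(a, b) and its two indeterminates. *)
Definition Qab : fieldType := {fraction {mpoly rat[2]}}.
Definition a_ : Qab := FracField.tofrac 'X_(ord0 : 'I_2).
Definition b_ : Qab := FracField.tofrac 'X_(ord_max : 'I_2).

(* Main.v *)
Require Import Defs.
From mathcomp Require Import all_boot all_order all_algebra all_field.
From mathcomp Require Import mpoly ring zify.
From Stdlib Require Import Classical.

Import GRing.Theory.
Local Open Scope ring_scope.

(* Over a splitting field write p = prod_i (1 - r_i X), where r_i^k = a r_i^(k-1) + b.
   The discriminant of p is nonzero, so the r_i are distinct and 1/p has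
   coefficients sum_i c_i r_i^n with all c_i nonzero; the coefficients of the
   Hadamard square are then combinations of the powers (r_i r_j)^n, i <= j, with
   nonzero coefficients.  If r s = q for roots r and s, multiplying
   r^(k-1) (r - a) = b by s^(k-1) (s - a) = b gives
   q^(k-1) (q - a (r + s) + a^2) = b^2, so q determines the pair {r, s}.  The
   products r_i r_j, i <= j, are thus distinct and the reduced denominator is
   prod_(i <= j) (1 - r_i r_j x).  Its diagonal part is p(sqrt x) p(- sqrt x).

   It remains to see that f = f_{k-1}(x; a, -b) is prod_(i < j) (1 - r_i r_j x).
   Reading the positions 1, ..., N = k - 1 from left to right and recording the
   parity of the number of partial sums met so far turns f into a product of
   2 x 2 transfer matrices, which gives deg f <= k (k - 1) / 2 and f(0) = 1.  At
   x = 1 / (r s), with W_m = r^m - s^m, the state after 2j (resp. 2j + 1)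
   positions is proportional to (W_{N-j}, - W_j) (resp. (W_{N-j}, - W_{j+1})),
   so f vanishes there, and the roots are accounted for. *)

(** * Odd compositions, built position by position *)

Section OddCompositions.
Set Implicit Arguments.
Unset Strict Implicit.

(** Stage [m.+1] decides whether position [m.+1] is a partial sum; if it is, the last part is
    forced. The transfer matrices follow this recursion on positions. *)
Fixpoint ocs (n : nat) : seq (seq nat) :=
  if n is m.+1 then
    ocs m ++ [seq rcons s (m.+1 - sumn s)%N | s <- ocs m & odd (m.+1 - sumn s)]
  else [:: [::]].

Lemma odd_sumn s : odd_composition s -> odd (sumn s) = odd (size s).
Proof. by elim: s => //= x s IHs /andP[xo so]; rewrite oddD xo IHs. Qed.

Lemma mem_ocs n s : (s \in ocs n) = odd_composition s && (sumn s <= n)%N.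
Proof.
elim: n s => [|n IHn] s /=.
  rewrite inE; case: s => //= x s.
  by case: x => //= x; rewrite andbF.
rewrite mem_cat IHn; apply/orP/andP => [[/andP[so le_s]|/mapP[t]]|[so le_s]].
- by rewrite so leqW.
- rewrite mem_filter IHn => /and3P[odd_t to le_t] ->.
  rewrite sumn_rcons; split; last by lia.
  by rewrite /odd_composition all_rcons odd_t.
- move: le_s; rewrite leq_eqVlt ltnS => /predU1P[sum_s|->]; last by rewrite so; left.
  right; case/lastP: s so sum_s => // t x.
  rewrite /odd_composition all_rcons sumn_rcons => /andP[xo to] sum_t.
  have x_gt0 : (0 < x)%N by case: x xo {sum_t}.
  have def_x : x = (n.+1 - sumn t)%N by lia.
  apply/mapP; exists t; last by rewrite -def_x.
  rewrite mem_filter IHn -def_x xo [odd_composition _]to /=; lia.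
Qed.

(** The partial sums of an odd composition alternate in parity, starting with odd, so position
    [n.+1] can come next only if [n] and [size s] have the same parity. *)
Lemma odd_last_part n s :
  s \in ocs n -> odd (n.+1 - sumn s) = odd n (+) ~~ odd (size s).
Proof.
rewrite mem_ocs => /andP[/odd_sumn sum_s le_s].
by rewrite oddB ?sum_s 1?ltnW //= addNb addbN.
Qed.

Lemma ocs_uniq n : uniq (ocs n).
Proof.
elim: n => //= n IHn; rewrite cat_uniq IHn /=; apply/andP; split.
  apply/hasPn => _ /mapP[t tin ->]; rewrite mem_ocs sumn_rcons.
  by move: tin; rewrite mem_filter mem_ocs => /and3P[_ _ le_t]; lia.
rewrite map_inj_in_uniq ?filter_uniq // => s t _ _.
by move/rcons_inj => [].
Qed.

Lemma S_rcons N s x :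
  S_ N (rcons s x) = (S_ N s + sigma N (sumn s + x))%N.
Proof.
rewrite /S_ size_rcons big_nat_recr //=; congr (_ + _)%N.
  rewrite !big_nat; apply: eq_bigr => i /andP[_ lt_i].
  by rewrite -cats1 takel_cat.
by rewrite -(size_rcons s x) take_size sumn_rcons.
Qed.

(* The exponent of a accumulated by s after the positions 1, ..., n: the number
   of those positions that are not partial sums of s and are preceded by an odd
   number of partial sums.  By expoE the subtraction is not truncated. *)
Definition expo N n (s : seq nat) : nat :=
  ((2 * S_ N s + odd (size s) * n) - (N.+1 * size s + odd (size s) * N))%N.

(** Twice sigma is 2N + 1 - i at an odd position i and j at an even position j. Consecutive partial
    sums i odd, j even thus contribute 2(N + 1) + (j - i - 1), where j - i - 1 counts the positions
    between them; an unpaired last i, with n added, contributes (N + 1) + N + (n - i). *)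
Lemma expoE N n s : (n <= N)%N -> s \in ocs n ->
  (2 * S_ N s + odd (size s) * n =
   N.+1 * size s + odd (size s) * N + expo N n s /\ expo N n s <= n)%N.
Proof.
move=> le_nN s_in; rewrite /expo.
suff [ge0 le_n] :
    ((N.+1 * size s + odd (size s) * N <= 2 * S_ N s + odd (size s) * n) /\
       (2 * S_ N s + odd (size s) * n <=
        N.+1 * size s + odd (size s) * N + n))%N by rewrite subnKC // leq_subLR.
elim: n le_nN s s_in => [|n IHn] lt_nN s /=.
  by rewrite inE => /eqP ->; rewrite /S_ big_nil /= !muln0.
rewrite mem_cat => /orP[|/mapP[t]].
  by move=> /(IHn (ltnW lt_nN)); case: odd => /=; rewrite ?mul1n ?mul0n; lia.
rewrite mem_filter => /andP[odd_t t_in] ->.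
have := IHn (ltnW lt_nN) _ t_in.
move: t_in; rewrite mem_ocs => /andP[/odd_sumn sum_t le_t].
rewrite S_rcons size_rcons /= /sigma subnKC; last by lia.
move: odd_t; rewrite oddB; last by lia.
rewrite sum_t /= divn2.
have := odd_double_half n; rewrite -!muln2.
case: (odd n); case: (odd (size t)) => //=; rewrite ?divn2 /= ?mulnS ?mul1n ?mul0n.
  lia.
by rewrite subn1 /=; lia.
Qed.

(** At n = N the two parity terms of [expoE] cancel, and [expo] is at most N. The remainder becomes
    a count that can be accumulated. *)
Lemma expo_rem N s : s \in ocs N -> expo N N s = rem_ N s.
Proof.
move=> /(expoE (leqnn N))[/eqP]; rewrite addnAC eqn_add2r => /eqP def_e le_e.
by rewrite /rem_ def_e mulnC modnMDl modn_small.
Qed.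

End OddCompositions.

(** * The transfer matrix recursion *)

Section TransferMatrix.
Set Implicit Arguments.
Unset Strict Implicit.
Variable R : comNzRingType.
Variables (N : nat) (a b : R).
Implicit Types s : seq nat.

Definition weight n s : {poly R} :=
  ((-1) ^+ ((size s + 1) %/ 2) * a ^+ expo N n s * b ^+ size s) *: 'X^(S_ N s).

(** With [odd_sum], the two coordinates of the state vector after n positions. *)
Definition even_sum n := \sum_(s <- ocs n | ~~ odd (size s)) weight n s.
Definition odd_sum n := \sum_(s <- ocs n | odd (size s)) weight n s.

Lemma f_sum_ocs : f_ N a b = even_sum N + odd_sum N.
Proof.
rewrite addrC -(bigID (fun s => odd (size s)) predT) /=.
pose mv (alpha : N.-bseq 'I_N.+1) := map val alpha.
pose w s : {poly R} :=
  ((-1) ^+ ((size s + 1) %/ 2) * a ^+ rem_ N s * b ^+ size s) *: 'X^(S_ N s).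
rewrite (eq_big_seq w) => [|s s_in]; last by rewrite /weight expo_rem.
pose P (alpha : N.-bseq 'I_N.+1) :=
  odd_composition (mv alpha) && (sumn (mv alpha) <= N)%N.
rewrite -[LHS]/(\sum_(alpha | P alpha) w (mv alpha)).
transitivity (\sum_(s <- map mv (filter P (index_enum _))) w s).
  by rewrite big_map big_filter.
apply: perm_big; apply: uniq_perm; last first.
- move=> s; rewrite mem_ocs; apply/mapP/idP => [[alpha]|s_ok].
    by rewrite mem_filter => /andP[Pa _] ->.
  (* Odd parts are at least 1, so there are at most N of them. *)
  have sz_s : (size s <= N)%N.
    case/andP: s_ok => so; apply: leq_trans.
    by elim: s so => //= x s IHs /andP[xo /IHs]; case: x xo => //=; lia.
  have le_s x : x \in s -> (x < N.+1)%N.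
    case/andP: s_ok => _ le_s x_in; rewrite ltnS; apply: leq_trans le_s.
    elim: s x_in {sz_s} => //= y s IHs; rewrite inE => /predU1P[->|/IHs]; lia.
  pose t : seq 'I_N.+1 := map inord s.
  have st : (size t <= N)%N by rewrite size_map.
  have vt : map val t = s.
    rewrite -map_comp map_id_in // => x /le_s ltx /=.
    by rewrite inordK.
  exists (Bseq st); last by rewrite /mv /= vt.
  by rewrite mem_filter mem_index_enum andbT /P /mv /= vt.
- exact: ocs_uniq.
- rewrite map_inj_in_uniq ?filter_uniq ?index_enum_uniq // => u v _ _ /= eq_uv.
  exact/val_inj/(inj_map val_inj).
Qed.

Lemma even_sum0 : even_sum 0 = 1.
Proof.
rewrite /even_sum /= big_cons big_nil /= addr0 /weight /expo /S_ big_nil /=.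
by rewrite !muln0 divn_small // !expr0 !mulr1 scale1r.
Qed.

Lemma odd_sum0 : odd_sum 0 = 0.
Proof. by rewrite /odd_sum /= big_cons big_nil. Qed.

Lemma weightS n s : (n < N)%N -> s \in ocs n ->
  weight n.+1 s = (if odd (size s) then a else 1) *: weight n s.
Proof.
move=> lt_nN s_in; rewrite /weight scalerA; congr (_ *: _).
have [e1 _] := expoE (ltnW lt_nN) s_in.
have s_in' : s \in ocs n.+1 by rewrite mem_cat s_in.
have [e2 _] := expoE lt_nN s_in'.
case: ifP e1 e2 => _ /= e1 e2.
  have -> : expo N n.+1 s = (expo N n s).+1 by lia.
  rewrite exprS; ring.
have -> : expo N n.+1 s = expo N n s by lia.
ring.
Qed.

(** Leaving an odd state uses an even position and keeps the sign; leaving an even state uses an odd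
    position and flips it, since floor((l + 1) / 2) grows from l to l + 1 exactly when l is even. *)
Lemma weight_rcons n s : (n < N)%N -> s \in ocs n ->
  odd (n.+1 - sumn s) ->
  weight n.+1 (rcons s (n.+1 - sumn s)%N) =
  (if odd (size s) then b *: 'X^(n.+1./2) else - b *: 'X^(N - n./2)) * weight n s.
Proof.
move=> lt_nN s_in odd_s.
have [e1 _] := expoE (ltnW lt_nN) s_in.
have s_in' : rcons s (n.+1 - sumn s)%N \in ocs n.+1.
  rewrite mem_cat; apply/orP; right; apply/mapP; exists s => //.
  by rewrite mem_filter odd_s.
have [] := expoE lt_nN s_in'.
move: s_in; rewrite mem_ocs => /andP[/odd_sumn sum_s le_s].
rewrite S_rcons size_rcons /= /sigma subnKC; last by lia.
move: odd_s; rewrite oddB; last by lia.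
rewrite sum_s /= !divn2 => odd_s.
have := odd_double_half (size s).
have := odd_double_half n; rewrite -!muln2 uphalf_half /weight S_rcons size_rcons.
rewrite subnKC /sigma /=; last by lia.
move: e1 odd_s; case Es: (odd (size s)); case En: (odd n) => //=.
all: rewrite ?mul1n ?mul0n ?mulnS => e1 _ half_n half_s e2 _.
  have -> : expo N n.+1 (rcons s (n.+1 - sumn s)%N) = expo N n s by lia.
  have -> : (((size s).+1 + 1) %/ 2 = (size s + 1) %/ 2)%N by lia.
  rewrite -scalerAl -scalerAr scalerA -exprD [(n.+1 %/ 2)%N]divn2 /= uphalf_half En.
  rewrite [(S_ N s + _)%N]addnC; congr (_ *: _); rewrite exprS; ring.
have -> : expo N n.+1 (rcons s (n.+1 - sumn s)%N) = expo N n s by lia.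
have -> : (((size s).+1 + 1) %/ 2 = ((size s + 1) %/ 2).+1)%N by lia.
rewrite -scalerAl -scalerAr scalerA -exprD subn1 [(n.+1.-1 %/ 2)%N]divn2 /=.
rewrite [(S_ N s + _)%N]addnC; congr (_ *: _); rewrite !exprS; ring.
Qed.

(** By parity, a partial sum at n + 1 leads from odd to even states when n is odd, and from even to
    odd states when n is even. With [odd_sumS], each step is thus a triangular matrix. *)
Lemma even_sumS n : (n < N)%N ->
  even_sum n.+1 = even_sum n + (if odd n then b *: 'X^(n.+1./2) * odd_sum n else 0).
Proof.
move=> lt_nN; rewrite /even_sum /= big_cat /= big_map big_filter_cond; congr (_ + _).
  rewrite big_seq_cond [RHS]big_seq_cond; apply: eq_bigr => s /andP[s_in se].
  by rewrite weightS // (negbTE se) scale1r.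
rewrite big_seq_cond.
case: ifP => odd_n; last first.
  apply: big_pred0 => s; apply/and3P => -[/odd_last_part ->].
  by rewrite size_rcons odd_n /= negbK => /negbTE ->.
rewrite /odd_sum big_distrr /= [RHS]big_seq_cond.
apply: eq_big => [s|s /and3P[s_in odd_s]].
  have [/odd_last_part ->|//] := boolP (s \in ocs n).
  by rewrite size_rcons odd_n /= !negbK andbb.
rewrite size_rcons /= negbK => os.
by rewrite weight_rcons // os.
Qed.

Lemma odd_sumS n : (n < N)%N ->
  odd_sum n.+1 = a *: odd_sum n - (if odd n then 0 else b *: 'X^(N - n./2) * even_sum n).
Proof.
move=> lt_nN; rewrite /odd_sum /= big_cat /= big_map big_filter_cond; congr (_ + _).
  rewrite scaler_sumr.
  rewrite big_seq_cond [RHS]big_seq_cond; apply: eq_bigr => s /andP[s_in so].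
  by rewrite weightS // so.
rewrite big_seq_cond.
case: ifP => odd_n.
  rewrite oppr0; apply: big_pred0 => s; apply/and3P => -[/odd_last_part ->].
  by rewrite size_rcons odd_n /= negbK => ->.
rewrite /even_sum -mulNr big_distrr /= [RHS]big_seq_cond.
apply: eq_big => [s|s /and3P[s_in odd_s]].
  have [/odd_last_part ->|//] := boolP (s \in ocs n).
  by rewrite size_rcons odd_n /= andbb.
rewrite size_rcons /= => os.
by rewrite weight_rcons // (negbTE os) scaleNr.
Qed.

End TransferMatrix.

(** * Degree and constant term of f *)

Section DegreeBound.
Set Implicit Arguments.
Unset Strict Implicit.
Variable R : comNzRingType.
Variables (N : nat) (a b : R).

(* Closed form of \sum_(1 <= i < n.+1) sigma N i. *)
Definition sigma_sum n : nat := (n./2 * N.+1 + odd n * (N - n./2))%N.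

Lemma size_ZXnM (c : R) m (p : {poly R}) d :
  (size p <= d.+1)%N -> (size (c *: 'X^m * p)%R <= (m + d).+1)%N.
Proof.
move=> le_p; rewrite -scalerAl (leq_trans (size_scale_leq _ _)) //.
by rewrite (leq_trans (size_polyMleq _ _)) // size_polyXn; lia.
Qed.

Lemma size_transfer_sums n : (n <= N)%N ->
  (size (even_sum N a b n) <= (sigma_sum n).+1)%N /\
  (size (odd_sum N a b n) <= (sigma_sum n).+1)%N.
Proof.
elim: n => [|n IHn] lt_nN.
  by rewrite even_sum0 odd_sum0 size_poly1 size_poly0.
have [IHe IHo] := IHn (ltnW lt_nN).
rewrite even_sumS // odd_sumS //.
have := odd_double_half n; rewrite -!muln2.
(* The increment is [sigma N n.+1], the power of X gained by a partial sum at n + 1. *)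
have -> : sigma_sum n.+1 = ((if odd n then n.+1./2 else (N - n./2)) + sigma_sum n)%N.
  have := odd_double_half n; rewrite -muln2.
  rewrite /sigma_sum /= uphalf_half; case: (odd n) => /= half_n; nia.
move=> half_n; split; apply: leq_trans (size_polyD _ _) _; rewrite geq_max.
  apply/andP; split; first by apply: leq_trans IHe _; rewrite ltnS leq_addl.
  by case: ifP => _; [apply: size_ZXnM | rewrite size_poly0].
apply/andP; split.
  apply: leq_trans (size_scale_leq _ _) _.
  by apply: leq_trans IHo _; rewrite ltnS leq_addl.
by rewrite size_polyN; case: ifP => _; [rewrite size_poly0 | apply: size_ZXnM].
Qed.

Lemma size_f : (size (f_ N a b) <= 'C(N.+1, 2).+1)%N.
Proof.
have [le_e le_o] := size_transfer_sums (leqnn N).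
(* [sigma N] permutes 1, ..., N, so its values add up to N (N + 1) / 2. *)
have -> : 'C(N.+1, 2) = sigma_sum N.
  rewrite bin2 /sigma_sum /= -divn2; have := odd_double_half N; rewrite -muln2.
  by case: (odd N) => /= half_N; nia.
by rewrite f_sum_ocs (leq_trans (size_polyD _ _)) // geq_max le_e.
Qed.

(** The even state feeds the odd one only through positive powers of X, so at 0 only the empty
    composition survives. *)
Lemma f_at0 : (f_ N a b).[0] = 1.
Proof.
suff [e0 o0] : (even_sum N a b N).[0] = 1 /\ (odd_sum N a b N).[0] = 0.
  by rewrite f_sum_ocs hornerD e0 o0 addr0.
suff: forall n, (n <= N)%N ->
  (even_sum N a b n).[0] = 1 /\ (odd_sum N a b n).[0] = 0 by apply.
elim=> [|n IHn] lt_nN; first by rewrite even_sum0 odd_sum0 !hornerE.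
have [e0 o0] := IHn (ltnW lt_nN).
have half_n := odd_double_half n; rewrite -muln2 in half_n.
rewrite even_sumS // odd_sumS //; split.
  by rewrite hornerD e0; case: ifP; rewrite ?hornerM ?o0 ?mulr0 ?horner0 addr0.
rewrite hornerD hornerN hornerZ o0 mulr0 add0r.
case: ifP => odd_n; rewrite ?horner0 ?oppr0 // hornerM hornerZ hornerXn.
rewrite expr0n subn_eq0 leqNgt (_ : n./2 < N)%N; last by lia.
by rewrite mulr0 mul0r oppr0.
Qed.

End DegreeBound.

(** * Vanishing of f at 1 / (r s) *)

Section Vanishing.
Set Implicit Arguments.
Unset Strict Implicit.
Variable F : fieldType.
Variables (N : nat) (a b r s x : F).
Hypothesis rE : r ^+ N.+1 = a * r ^+ N + b.
Hypothesis sE : s ^+ N.+1 = a * s ^+ N + b.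
Hypothesis neq_rs : r != s.
Hypothesis xE : x * (r * s) = 1.

Let W n := r ^+ n - s ^+ n.

Let r_neq0 : r != 0.
Proof. by apply: contra_eq_neq xE => ->; rewrite mul0r mulr0 eq_sym oner_eq0. Qed.

(** [aW] and [bW] solve the two root equations, linear in a and b; their determinant is [W N] up to
    sign. *)
Let aW : a * W N = W N.+1.
Proof. by rewrite /W rE sE; ring. Qed.

Let bW : b * W N = - ((r * s) ^+ N * (r - s)).
Proof.
have -> : b = r ^+ N.+1 - a * r ^+ N by rewrite rE; ring.
rewrite mulrBl mulrAC aW /W exprMn !exprS; ring.
Qed.

Let W_neq0 : W N != 0.
Proof.
apply: contra_neq neq_rs => W0.
have /eqP : r ^+ N * (r - s) = 0.
  have rs_N : r ^+ N = s ^+ N by apply/eqP; rewrite -subr_eq0 -/(W N) W0.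
  by have := aW; rewrite W0 mulr0 /W !exprS -rs_N => W1; rewrite W1; ring.
by rewrite mulf_eq0 expf_eq0 (negbTE r_neq0) andbF subr_eq0 => /eqP.
Qed.

Let xX m n : (r * s) ^+ (m + n) * x ^+ n = (r * s) ^+ m.
Proof. by rewrite exprD -mulrA -exprMn [_ * x]mulrC xE expr1n mulr1. Qed.

Lemma transfer_sums_at_root n : (n <= N)%N ->
  exists c, (even_sum N a (- b) n).[x] = c * W (N - n./2) /\
            (odd_sum N a (- b) n).[x] = - c * W (uphalf n).
Proof.
elim: n => [|n IHn] lt_nN.
  (* The initial state (1, 0) fits because W_0 = 0. *)
  exists (W N)^-1; rewrite even_sum0 odd_sum0 !hornerE subn0 mulVf //.
  by rewrite /W !expr0 subrr mulr0.
have [c [Ee Oe]] := IHn (ltnW lt_nN).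
rewrite even_sumS // odd_sumS //.
have half_n := odd_double_half n; rewrite -muln2 in half_n.
move: half_n Ee Oe; rewrite /= uphalf_half; case: (odd n) => /= half_n Ee Oe.
  have [m Nm] : exists m, N = (m + n./2.+1)%N by exists (N - n./2.+1)%N; lia.
  (* The odd coordinate is only multiplied by a here, which forces the new constant. *)
  exists (c * a); rewrite !hornerE Ee Oe; split; last by ring.
  have -> : (N - n./2)%N = m.+1 by lia.
  rewrite add1n; have -> : (N - n./2.+1)%N = m by lia.
  (* Multiplying by W_N lets [aW], [bW] and [xX] eliminate a, b and x. What remains is W_N W_(m+1) -
     W_(N+1) W_m = (r s)^m (r - s) W_(N-m); the even case uses the same identity with n/2 for m. *)
  apply: (mulIf W_neq0).
  have -> : (c * W m.+1 + - b * x ^+ n./2.+1 * (- c * W n./2.+1)) * W N =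
    c * (W N * W m.+1 + b * W N * x ^+ n./2.+1 * W n./2.+1) by ring.
  have -> : c * a * W m * W N = c * (a * W N * W m) by ring.
  rewrite aW bW {2 3}Nm; congr (_ * _).
  rewrite mulNr mulrAC xX /W Nm !exprMn !(exprD, exprS); ring.
have [m Nm] : exists m, N = (m + n./2)%N by exists (N - n./2)%N; lia.
exists c; rewrite add0n !hornerE Ee Oe; split=> //.
have -> : (N - n./2)%N = m by lia.
apply: (mulIf W_neq0).
have -> : (a * (- c * W n./2) - - b * x ^+ m * (c * W m)) * W N =
  - c * (a * W N * W n./2 - b * W N * x ^+ m * W m) by ring.
rewrite aW bW -[in RHS]mulrA; congr (_ * _).
rewrite {2 3}Nm [(m + _)%N]addnC mulNr mulrAC xX /W Nm.
rewrite !exprMn !(exprD, exprS); ring.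
Qed.

(** At n = N both coordinates carry the same W, with opposite signs. *)
Lemma f_root : (f_ N a (- b)).[x] = 0.
Proof.
have [c [Ee Oe]] := transfer_sums_at_root (leqnn N).
rewrite f_sum_ocs hornerD Ee Oe.
have -> : (N - N./2 = uphalf N)%N.
  by have := odd_double_half N; rewrite uphalf_half -muln2; lia.
ring.
Qed.

End Vanishing.

(** * Partial fractions with simple poles *)

Section PartialFractions.
Set Implicit Arguments.
Unset Strict Implicit.
Variables (F : fieldType) (I : finType) (P : pred I) (q e : I -> F).

Definition pole_prod : {poly F} := \prod_(i | P i) (1 - q i *: 'X).

(** The sum of the e_i / (1 - q_i X) is [pole_num / pole_prod], and [power_sum] gives its series
    coefficients. *)
Definition pole_num : {poly F} :=
  \sum_(i | P i) e i *: \prod_(j | P j && (j != i)) (1 - q j *: 'X).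

Definition power_sum n : F := \sum_(i | P i) e i * q i ^+ n.

Lemma geometric_poly (c : F) n :
  (1 - c *: 'X) * \poly_(i < n) c ^+ i = 1 - c ^+ n *: 'X^n.
Proof.
rewrite -exprZn -[RHS]opprB subrX1 poly_def -mulNr opprB; congr (_ * _).
by apply: eq_bigr => i _; rewrite exprZn.
Qed.

Lemma coef_pole_prodM n m : (m <= n)%N ->
  (pole_prod * \poly_(i < n.+1) power_sum i)`_m = pole_num`_m.
Proof.
move=> le_mn.
have -> : \poly_(i < n.+1) power_sum i =
    \sum_(i | P i) e i *: \poly_(j < n.+1) q i ^+ j.
  apply/polyP => j; rewrite coef_poly coef_sum; case: ifP => lt_j.
    by apply: eq_bigr => i _; rewrite coefZ coef_poly lt_j.
  by rewrite big1 // => i _; rewrite coefZ coef_poly lt_j mulr0.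
rewrite mulr_sumr !coef_sum; apply: eq_bigr => i Pi.
rewrite -scalerAr !coefZ; congr (_ * _).
rewrite /pole_prod (bigD1 i) //= mulrAC geometric_poly mulrBl mul1r coefB.
by rewrite -scalerAl coefZ coefXnM ltnS le_mn mulr0 subr0.
Qed.

Lemma horner_pole_num i : P i -> q i != 0 ->
  pole_num.[(q i)^-1] = e i * \prod_(j | P j && (j != i)) (1 - q j / q i).
Proof.
move=> Pi qi0; rewrite /pole_num horner_sum (bigD1 i) //= [X in _ + X]big1 ?addr0.
  by rewrite hornerZ horner_prod; congr (_ * _); apply: eq_bigr => j _; rewrite !hornerE.
move=> j /andP[Pj ne_ji]; rewrite hornerZ horner_prod (bigD1 i) /=; last first.
  by rewrite Pi eq_sym.
rewrite (_ : (1 - q i *: 'X).[(q i)^-1] = 0) ?mul0r ?mulr0 //.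
by rewrite !hornerE divff ?subrr.
Qed.

Hypothesis q_neq0 : forall i, P i -> q i != 0.
Hypothesis q_inj : {in P &, injective q}.

Lemma prod_pole_neq0 i : P i ->
  \prod_(j | P j && (j != i)) (1 - q j / q i) != 0.
Proof.
move=> Pi; apply/prodf_neq0 => j /andP[Pj ne_ji].
rewrite subr_eq0 eq_sym; apply: contra ne_ji => /eqP q_ji.
by apply/eqP/q_inj => //; rewrite -[RHS]mul1r -q_ji divfK ?q_neq0.
Qed.

(** The difference of the two sides has the #|P| + 1 distinct roots 0 and 1 / q_i, too many for its
    degree. *)
Lemma poly_pole_prod (p : {poly F}) :
  (size p <= #|P|.+1)%N -> p.[0] = 1 ->
  (forall i, P i -> p.[(q i)^-1] = 0) -> p = pole_prod.
Proof.
move=> le_p p0 p_root; apply/eqP; rewrite -subr_eq0; apply/eqP.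
set d := p - _.
have le_d : (size d <= #|P|.+1)%N.
  rewrite (leq_trans (size_polyD _ _)) // geq_max le_p size_polyN.
  rewrite (leq_trans (size_poly_prod_leq _ _)) // leq_subLR.
  rewrite addnS ltnS -sum1_card -big_split /=; apply: leq_sum => i _.
  rewrite (leq_trans (size_polyD _ _)) // geq_max size_poly1 size_polyN.
  by rewrite (leq_trans (size_scale_leq _ _)) ?size_polyX.
apply/eqP; apply: contraTT le_d => d_neq0; rewrite -ltnNge.
have := @max_poly_roots _ d (0 :: [seq (q i)^-1 | i <- enum P]) d_neq0.
rewrite /= size_map -cardE; apply.
  apply/andP; split.
    rewrite /root hornerD hornerN p0 horner_prod big1 ?subrr // => i _.
    by rewrite !hornerE ?mulr0 ?subr0.
  apply/allP => x /mapP[i]; rewrite mem_enum => Pi ->.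
  rewrite /root hornerD hornerN p_root // horner_prod (bigD1 i) //=.
  by rewrite [(1 - q i *: 'X).[_]](_ : _ = 0) ?mul0r ?subr0 // !hornerE divff ?q_neq0 ?subrr.
apply/andP; split.
  apply/mapP => -[i]; rewrite mem_enum => Pi /eqP.
  by rewrite eq_sym invr_eq0 (negbTE (q_neq0 Pi)).
rewrite map_inj_in_uniq ?enum_uniq // => i j; rewrite !mem_enum => Pi Pj.
by move/invr_inj/q_inj; apply.
Qed.

Hypothesis e_neq0 : forall i, P i -> e i != 0.

(** At 1 / q_i only the i-th summand of [pole_num] survives, and it is nonzero since the q_j are
    distinct. *)
Lemma coprimep_pole_num : coprimep pole_num pole_prod.
Proof.
rewrite /pole_prod; apply: (big_ind (coprimep pole_num)).
- exact: coprimep1.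
- by move=> u v cu cv; rewrite coprimepMr cu.
move=> i Pi; have qi0 := q_neq0 Pi.
have -> : 1 - q i *: 'X = - q i *: ('X - ((q i)^-1)%:P).
  rewrite scalerBr !scaleNr opprK [RHS]addrC; congr (_ - _).
  by rewrite -mul_polyC -polyCM divff.
rewrite coprimepZr ?oppr_eq0 // coprimep_XsubC /root horner_pole_num //.
by rewrite mulf_neq0 ?e_neq0 ?prod_pole_neq0.
Qed.

Lemma coefM_eq_low (c p p' : {poly F}) m :
  (forall i, (i <= m)%N -> p`_i = p'`_i) -> (c * p)`_m = (c * p')`_m.
Proof.
by move=> eq_p; rewrite !coefM; apply: eq_bigr => i _; rewrite eq_p ?leq_subr.
Qed.

Lemma reduced_denominator (H1 H2 : {poly F}) :
  fps_mul (fps_of_poly H2) power_sum =1 fps_of_poly H1 ->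
  coprimep H1 H2 -> H2 %= pole_prod.
Proof.
move=> H12 co_H.
(* Two fractions for one series, cross-multiplied; the coefficient of degree m only sees the series
   truncated after m. Both fractions being reduced, Gauss then gives the two divisibilities. *)
have H_eq : H1 * pole_prod = H2 * pole_num.
  apply/polyP => m; rewrite mulrC.
  pose h := \poly_(i < m.+1) power_sum i.
  transitivity ((pole_prod * (H2 * h))`_m).
    apply: coefM_eq_low => i le_im; rewrite -[LHS]H12 coefM; apply: eq_bigr => j _.
    by rewrite coef_poly ltnS (leq_trans (leq_subr _ _)).
  rewrite mulrCA; apply: coefM_eq_low => i le_im.
  exact: coef_pole_prodM.
rewrite /eqp; apply/andP; split.
  by rewrite -(Gauss_dvdpr _ (_ : coprimep H2 H1)) 1?coprimep_sym // H_eq dvdp_mulr.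
by rewrite -(Gauss_dvdpl _ (_ : coprimep pole_prod pole_num)) 1?coprimep_sym
  ?coprimep_pole_num // -H_eq dvdp_mull.
Qed.

End PartialFractions.

(** * Partial fractions of the inverse of a product *)

Section InversePartialFractions.
Set Implicit Arguments.
Unset Strict Implicit.
Variables (F : fieldType) (n : nat) (r : 'I_n.+1 -> F).
Hypothesis r_neq0 : forall i, r i != 0.
Hypothesis r_inj : injective r.

Definition residue i : F := (\prod_(j | j != i) (1 - r j / r i))^-1.

Lemma residue_neq0 i : residue i != 0.
Proof.
rewrite invr_eq0; apply: (@prod_pole_neq0 _ _ predT) => //.
by move=> ? ? _ _; apply: r_inj.
Qed.

(** The residues make the numerator equal 1 at the n + 1 points 1 / r_i, and its degree is at most
    n. *)
Lemma pole_num_residue : pole_num predT r residue = 1.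
Proof.
apply/eqP; rewrite -subr_eq0; set d := _ - 1.
have le_d : (size d <= n.+1)%N.
  rewrite (leq_trans (size_polyD _ _)) // geq_max size_polyN size_poly1 andbT.
  apply: (leq_trans (size_sum _ _ _)); apply/bigmax_leqP => i _.
  rewrite (leq_trans (size_scale_leq _ _)) //.
  rewrite (leq_trans (size_poly_prod_leq _ _)) // leq_subLR.
  have -> : (#|(fun j => predT j && (j != i))| = n)%N.
    by rewrite (cardC1 i) card_ord.
  rewrite addnS ltnS.
  apply: (@leq_trans (\sum_(j | predT j && (j != i)) 2)).
    apply: leq_sum => j _.
    rewrite (leq_trans (size_polyD _ _)) // geq_max size_poly1 size_polyN.
    by rewrite (leq_trans (size_scale_leq _ _)) ?size_polyX.
  by rewrite sum_nat_const (cardC1 i) card_ord /= muln2 -addnn.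
apply: contraTT le_d => d_neq0; rewrite -ltnNge.
have := @max_poly_roots _ d [seq (r i)^-1 | i <- enum 'I_n.+1] d_neq0.
rewrite size_map size_enum_ord; apply.
  apply/allP => _ /mapP[i _ ->].
  rewrite /root hornerD hornerN hornerC horner_pole_num // /residue mulVf ?subrr //.
  by have := residue_neq0 i; rewrite invr_eq0.
by rewrite map_inj_uniq ?enum_uniq // => i j /invr_inj /r_inj.
Qed.

(** The power sums also invert the product, and its constant term 1 makes the inverse unique,
    coefficient by coefficient. *)
Lemma fps_inv_power_sum (g : fps F) :
  fps_mul g (fps_of_poly (pole_prod predT r)) =1 (fun m => (m == 0)%:R) ->
  g =1 power_sum predT r residue.
Proof.
set p := pole_prod _ _ => gp; set h := power_sum _ _ _.
have p0 : p`_0 = 1.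
  by rewrite -horner_coef0 horner_prod big1 // => i _; rewrite !hornerE ?mulr0 ?subr0.
have hp m : \sum_(i < m.+1) h i * p`_(m - i) = (m == 0)%:R.
  have := coef_pole_prodM predT r residue (leqnn m).
  rewrite pole_num_residue coef1 mulrC coefM => <-.
  by apply: eq_bigr => i _; rewrite coef_poly ltn_ord.
move=> m; elim/ltn_ind: m => m IHm.
have := gp m; rewrite -(hp m) /fps_mul !big_ord_recr /= subnn /fps_of_poly p0 !mulr1.
rewrite (eq_bigr (fun i : 'I_m => h i * p`_(m - i))) => [|i _]; last by rewrite IHm.
exact: addrI.
Qed.

End InversePartialFractions.

(** * Splitting fields over an arbitrary field *)

Section SplittingField.
Set Implicit Arguments.
Unset Strict Implicit.

Lemma irreducible_factor (F : fieldType) (p : {poly F}) :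
  (1 < size p)%N -> exists2 q, irreducible_poly q & q %| p.
Proof.
have [n] := ubnP (size p); elim: n p => // n IHn p lt_pn gt1_p.
have [irr_p|red_p] := classic (irreducible_poly p); first by exists p.
have p_neq0 : p != 0 by rewrite -size_poly_gt0 ltnW.
have [q [q_size q_p ne_qp]] : exists q : {poly F}, [/\ size q != 1%N, q %| p & ~~ (q %= p)].
  apply: NNPP => no_q; apply: red_p; split=> // q sz_q q_p.
  by apply/negPn/negP => ne_qp; apply: no_q; exists q.
have q_neq0 : q != 0 by apply: contraNneq p_neq0 => q0; rewrite -dvd0p -q0.
have lt_qp : (size q < size p)%N.
  by rewrite ltn_neqAle dvdp_leq // dvdp_size_eqp // ne_qp.
have [||s irr_s s_q] := IHn q.
- exact: leq_trans lt_qp _.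
- by rewrite ltn_neqAle eq_sym q_size size_poly_gt0.
by exists s => //; apply: dvdp_trans q_p.
Qed.

(** Adjoin a root of an irreducible factor, divide by the linear factor and recurse over the larger
    field. *)
Lemma splitting_field (F : fieldType) (p : {poly F}) : p != 0 ->
  exists (L : fieldType) (f : {rmorphism F -> L}) (s : seq L),
    map_poly f p %= \prod_(z <- s) ('X - z%:P).
Proof.
have [n] := ubnP (size p); elim: n F p => // n IHn F p lt_pn p_neq0.
have [le_p1|gt1_p] := leqP (size p) 1.
  exists F, idfun, [::]; rewrite big_nil map_poly_id // -size_poly_eq1.
  by rewrite eqn_leq le_p1 size_poly_gt0.
have [q irr_q q_p] := irreducible_factor gt1_p.
have [L0 _ [z root_z _]] := irredp_FAdjoin irr_q.
pose p0 := map_poly (GRing.in_alg L0) p.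
have : root p0 z by apply: root_dvdp root_z; rewrite dvdp_map.
case/factor_theorem => p1 def_p0.
have p0_neq0 : p0 != 0 by rewrite map_poly_eq0.
have p1_neq0 : p1 != 0 by apply: contraNneq p0_neq0 => p10; rewrite def_p0 p10 mul0r.
have sz_p1 : (size p1).+1 = size p.
  rewrite -(size_map_poly (GRing.in_alg L0)) -/p0 def_p0.
  by rewrite size_Mmonic ?monicXsubC // size_XsubC addn2.
have [|L [f [s eq_s]]] := IHn L0 p1 _ p1_neq0; first by rewrite -ltnS sz_p1.
exists L, (f \o GRing.in_alg L0), (f z :: s).
rewrite map_poly_comp -/p0 def_p0 rmorphM /= map_polyXsubC big_cons mulrC.
exact: eqp_mull.
Qed.

End SplittingField.

(** * Pairwise products of the inverse roots *)

Section TrinomialRoots.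
Set Implicit Arguments.
Unset Strict Implicit.
Variable F : fieldType.
Variables (N : nat) (a b : F).
Hypotheses (a_neq0 : a != 0) (b_neq0 : b != 0) (two_neq0 : 2 != 0 :> F).

(** For r nonzero this says that 1 / r is a root of p. *)
Definition char_root (r : F) := r ^+ N.+1 = a * r ^+ N + b.

Lemma char_root_neq0 r : (0 < N)%N -> char_root r -> r != 0.
Proof.
move=> N_gt0 r_root; apply: contra_neq b_neq0 => r0.
by move: r_root; rewrite /char_root r0 !expr0n (gtn_eqF N_gt0) mulr0 add0r.
Qed.

(* Multiplying r^N (r - a) = b by s^N (s - a) = b expresses r + s through
   r * s. *)
Lemma char_root_pair_eq r s u v : (0 < N)%N ->
  char_root r -> char_root s -> char_root u -> char_root v ->
  r * s = u * v -> (r = u /\ s = v) \/ (r = v /\ s = u).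
Proof.
move=> N_gt0 r_root s_root u_root v_root rs_uv.
have r_neq0 := char_root_neq0 N_gt0 r_root.
have s_neq0 := char_root_neq0 N_gt0 s_root.
have prod_eq x y : char_root x -> char_root y ->
    (x * y) ^+ N * (x * y - a * (x + y) + a ^+ 2) = b ^+ 2.
  rewrite /char_root => xE yE.
  have bx : b = x ^+ N * (x - a).
    by rewrite mulrBr -exprSr xE; ring.
  have by_ : b = y ^+ N * (y - a).
    by rewrite mulrBr -exprSr yE; ring.
  by rewrite [b ^+ 2]expr2 {1}bx by_ exprMn; ring.
have := prod_eq _ _ r_root s_root; rewrite -(prod_eq _ _ u_root v_root) rs_uv.
have uv_neq0 : (u * v) ^+ N != 0 by rewrite expf_neq0 // -rs_uv mulf_neq0.
move/(mulfI uv_neq0)/addIr/addrI/oppr_inj/(mulfI a_neq0) => sum_eq.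
have /eqP : (u - r) * (u - s) = 0.
  have -> : (u - r) * (u - s) = u * u - u * (r + s) + r * s by ring.
  by rewrite rs_uv sum_eq; ring.
rewrite mulf_eq0 !subr_eq0 => /orP[/eqP ur|/eqP us].
  left; split=> //; apply: (addrI r); rewrite sum_eq ur; ring.
right; split=> //; apply: (addIr s); rewrite sum_eq us; ring.
Qed.

Hypothesis N_gt0 : (0 < N)%N.
Variable r : 'I_N.+1 -> F.
Hypothesis r_inj : injective r.
Hypothesis r_root : forall i, char_root (r i).

Let r_neq0 i : r i != 0.
Proof. exact: char_root_neq0 (r_root i). Qed.

Notation pair := ('I_N.+1 * 'I_N.+1)%type.
Let q (u : pair) : F := r u.1 * r u.2.

Lemma pair_prod_neq0 u : q u != 0.
Proof. by rewrite mulf_neq0. Qed.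

Lemma pair_prod_inj : {in [pred u : pair | (u.1 <= u.2)%N] &, injective q}.
Proof.
move=> [i j] [k l]; rewrite !inE /= => le_ij le_kl.
move=> /(char_root_pair_eq N_gt0 (r_root _) (r_root _) (r_root _) (r_root _)).
case=> -[/r_inj /= ik /r_inj /= jl]; first by rewrite ik jl.
(* In the swapped case the two orderings force all indices to be equal. *)
rewrite ik jl in le_ij *.
by have -> : l = k by apply/val_inj/anti_leq; rewrite le_ij.
Qed.

Lemma card_ltn_pairs : #|[pred u : pair | (u.1 < u.2)%N]| = 'C(N.+1, 2).
Proof.
rewrite -sum1_card -(pair_big_dep xpredT (fun i j : 'I_N.+1 => (i < j)%N) (fun _ _ => 1%N)) /=.
rewrite (exchange_big_dep xpredT) //= -bin2_sum big_mkord; apply: eq_bigr => j _.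
by rewrite -(big_ord_widen N.+1 (fun _ => 1%N) (ltnW (ltn_ord j))) sum1_card card_ord.
Qed.

Lemma f_factorization :
  f_ N a (- b) = pole_prod [pred u : pair | (u.1 < u.2)%N] q.
Proof.
apply: poly_pole_prod => [u _|u v|||u].
- exact: pair_prod_neq0.
- by rewrite !inE => /ltnW lt_u /ltnW lt_v; apply: pair_prod_inj.
- by rewrite card_ltn_pairs size_f.
- exact: f_at0.
rewrite inE => lt_u; apply: f_root (r_root u.1) (r_root u.2) _ _.
  by apply: contraTneq lt_u => /r_inj ->; rewrite ltnn.
by rewrite mulVf // pair_prod_neq0.
Qed.

Hypothesis p_prod : p_ N.+1 a b = pole_prod predT r.

(** The pairs i < j give f; the diagonal gives 1 - r_i^2 y^2 = (1 - r_i y)(1 + r_i y), hence p(y)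
    p(-y). *)
Lemma pole_prod_pairs :
  pole_prod [pred u : pair | (u.1 <= u.2)%N] q \Po 'X^2 =
  p_ N.+1 a b * (p_ N.+1 a b \Po (- 'X)) * (f_ N a (- b) \Po 'X^2).
Proof.
have -> : pole_prod [pred u : pair | (u.1 <= u.2)%N] q =
    (\prod_i (1 - (r i * r i) *: 'X)) * f_ N a (- b).
  rewrite f_factorization /pole_prod.
  rewrite -(pair_big_dep xpredT (fun i j : 'I_N.+1 => (i <= j)%N)
    (fun i j => 1 - (r i * r j) *: 'X)) /=.
  rewrite -(pair_big_dep xpredT (fun i j : 'I_N.+1 => (i < j)%N)
    (fun i j => 1 - (r i * r j) *: 'X)) /=.
  rewrite -big_split /=; apply: eq_bigr => i _.
  rewrite (bigD1 i) //=; congr (_ * _); apply: eq_bigl => j.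
  by rewrite ltn_neqAle andbC eq_sym.
rewrite comp_polyM; congr (_ * _).
rewrite p_prod /pole_prod !rmorph_prod -big_split /=; apply: eq_bigr => i _.
rewrite !(comp_polyB, comp_polyZ, comp_polyC, comp_polyX) /= scalerN opprK.
by rewrite -!mul_polyC polyCM polyC1 -!expr2 -exprMn -subr_sqr expr1n.
Qed.

Let c := residue r.

(** Each pair i < j arises twice in the square, as (i, j) and (j, i). The resulting factor 2 must be
    nonzero for every pole to be present. *)
Lemma hadamard_square_power_sum n :
  power_sum predT r c n * power_sum predT r c n =
  power_sum [pred u : pair | (u.1 <= u.2)%N] q
    (fun u => (c u.1 * c u.2) *+ (1 + (u.1 < u.2)%N)) n.
Proof.
pose G (u : pair) := c u.1 * r u.1 ^+ n * (c u.2 * r u.2 ^+ n).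
rewrite /power_sum big_distrl /=.
under eq_bigr => i _ do rewrite big_distrr /=.
rewrite pair_big /= -/(\sum_u G u) (bigID (fun u : pair => (u.1 <= u.2)%N)) /=.
have -> : \sum_(u : pair | ~~ (u.1 <= u.2)%N) G u =
    \sum_(u : pair | (u.1 <= u.2)%N && (u.1 < u.2)%N) G u.
  rewrite (reindex_inj (h := fun u : pair => (u.2, u.1))) /=; last first.
    by move=> [? ?] [? ?] /= [-> ->].
  apply: eq_big => [u|u _]; last by rewrite /G mulrC.
  by rewrite -ltnNge; case: ltngtP.
rewrite big_mkcondr -big_split; apply: eq_bigr => u _ /=.
rewrite /G /q exprMn; case: (_ < _)%N; rewrite /= ?mulr2n; ring.
Qed.

(** Any g inverse to p is allowed, so that an inverse computed over a subfield can be transported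
    here. *)
Lemma hadamard_denominator (g : fps F) (H1 H2 : {poly F}) :
  fps_mul g (fps_of_poly (p_ N.+1 a b)) =1 (fun m => (m == 0)%:R) ->
  fps_mul (fps_of_poly H2) (hadamard g g) =1 fps_of_poly H1 ->
  coprimep H1 H2 ->
  H2 \Po 'X^2 %=
  p_ N.+1 a b * (p_ N.+1 a b \Po (- 'X)) * (f_ N a (- b) \Po 'X^2).
Proof.
rewrite p_prod => /(fps_inv_power_sum r_neq0 r_inj) gE H12 co_H.
rewrite -p_prod -pole_prod_pairs.
suff /eqpf_eq[d d_neq0 ->] : H2 %= pole_prod [pred u : pair | (u.1 <= u.2)%N] q.
  by rewrite comp_polyZ eqp_scale.
apply: (@reduced_denominator _ _ _ _
  (fun u => (c u.1 * c u.2) *+ (1 + (u.1 < u.2)%N)) _ _ _ H1) => //.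
- by move=> u _; apply: pair_prod_neq0.
- exact: pair_prod_inj.
- move=> u _; have cu i : c i != 0 by apply: residue_neq0.
  by rewrite -mulr_natr !mulf_neq0 //; case: (_ < _)%N; rewrite //= oner_neq0.
move=> m; rewrite -H12; apply: eq_bigr => i _; congr (_ * _).
by rewrite /hadamard !gE hadamard_square_power_sum.
Qed.

End TrinomialRoots.

(** * Splitting the trinomial into distinct factors *)

Section Trinomial.
Set Implicit Arguments.
Unset Strict Implicit.

Lemma p_at0 (R : comNzRingType) N (a b : R) : (p_ N.+1 a b).[0] = 1.
Proof. by rewrite /p_ !hornerE expr0n !mulr0 !subr0. Qed.

Lemma map_p (R S : comNzRingType) (f : {rmorphism R -> S}) k a b :
  map_poly f (p_ k a b) = p_ k (f a) (f b).
Proof. by rewrite /p_ !rmorphB rmorph1 /= !map_polyZ map_polyX map_polyXn. Qed.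

Lemma map_f (R S : comNzRingType) (f : {rmorphism R -> S}) N a b :
  map_poly f (f_ N a b) = f_ N (f a) (f b).
Proof.
rewrite /f_ rmorph_sum; apply: eq_bigr => s _ /=.
by rewrite map_polyZ map_polyXn !rmorphM !rmorphXn rmorphN rmorph1.
Qed.

Variable F : fieldType.
Variables (N : nat) (a b : F).
Hypothesis N_gt0 : (0 < N)%N.
Hypothesis b_neq0 : b != 0.

Lemma size_p : size (p_ N.+1 a b) = N.+2.
Proof.
rewrite /p_ addrC -scaleNr size_polyDl size_scale ?oppr_eq0 ?size_polyXn //.
rewrite (leq_ltn_trans (size_polyD _ _)) // gtn_max size_poly1 size_polyN.
by rewrite (leq_ltn_trans (size_scale_leq _ _)) ?size_polyX.
Qed.

(* N.+1 ^ N.+1 * b + N ^ N * a ^ N.+1 is, up to sign and a power of b, the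
   discriminant of p. *)
Lemma split_trinomial (s : seq F) :
  N.+1%:R ^+ N.+1 * b + N%:R ^+ N * a ^+ N.+1 != 0 ->
  p_ N.+1 a b %= \prod_(z <- s) ('X - z%:P) ->
  exists r : 'I_N.+1 -> F, [/\ injective r, forall i, char_root N a b (r i) &
    p_ N.+1 a b = pole_prod predT r].
Proof.
move=> disc_neq0 p_eq; set p := p_ _ _ _ in p_eq *.
have sz_s : size s = N.+1.
  by have := eqp_size p_eq; rewrite size_p size_prod_XsubC => -[].
have s_root z : z \in s -> a * z + b * z ^+ N.+1 = 1.
  rewrite -root_prod_XsubC -(eqp_root p_eq) /root !hornerE.
  by rewrite -addrA -opprD subr_eq0 => /eqP.
have s_neq0 z : z \in s -> z != 0.
  by move/s_root; apply: contra_eq_neq => ->; rewrite expr0n !mulr0 addr0 eq_sym oner_neq0.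
have s_uniq : uniq s.
  rewrite -separable_prod_XsubC -(eqp_separable p_eq) unlock (eqp_coprimepl _ p_eq) coprimep_sym.
  rewrite big_seq; apply: (big_ind (coprimep p^`())).
  - exact: coprimep1.
  - by move=> u v cu cv; rewrite coprimepMr cu.
  move=> z z_s; rewrite coprimep_XsubC; apply: contra disc_neq0 => /eqP.
  rewrite /p /p_ !derivE !hornerE hornerMn hornerXn /= -mulr_natr => /eqP.
  rewrite -opprD oppr_eq0 addr_eq0 => /eqP aE.
  have pz := s_root z z_s; have z_neq0 := s_neq0 z z_s.
  (* At a double root z, p'(z) = 0 and p(z) = 0 give N a z = N + 1, so N^N (a z)^(N+1) = (N + 1)^N a
     z = - (N + 1)^(N+1) b z^(N+1): the discriminant vanishes. *)
  have az : a * z = - (N.+1%:R * (b * z ^+ N.+1)) by rewrite {1}aE exprS; ring.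
  have Naz : N%:R * (a * z) = N.+1%:R.
    have -> : N%:R = N.+1%:R - 1 :> F by rewrite -natr1 addrK.
    by rewrite mulrBl mul1r {2}az opprK -mulrDr pz mulr1.
  apply/eqP/(mulIf (expf_neq0 N.+1 z_neq0)); rewrite mul0r mulrDl.
  rewrite -[_ * _ * z ^+ _]mulrA -[N%:R ^+ N * _ * _]mulrA -exprMn.
  rewrite [(a * z) ^+ _]exprSr [N%:R ^+ N * _]mulrA -exprMn Naz.
  by rewrite [X in X * _]exprSr -mulrA az mulrN subrr.
pose r (i : 'I_N.+1) := (s`_i)^-1.
have mem_s (i : 'I_N.+1) : s`_i \in s by rewrite mem_nth ?sz_s.
exists r; split.
- move=> i j /invr_inj /eqP; rewrite nth_uniq ?sz_s // => /eqP; exact: val_inj.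
- move=> i; have := s_root _ (mem_s i); have := s_neq0 _ (mem_s i).
  rewrite /char_root /r; set z := s`_i => z_neq0 pz.
  apply: (mulIf (expf_neq0 N.+1 z_neq0)).
  rewrite mulrDl -exprMn mulVf // expr1n -[1]pz; congr (_ + _).
  by rewrite exprSr mulrA -[a * _ * _]mulrA -exprMn mulVf // expr1n mulr1.
have prod_eq : \prod_(z <- s) ('X - z%:P) = \prod_(z <- s) (- z) *: pole_prod predT r.
  rewrite /pole_prod (big_nth 0) [X in X *: _](big_nth 0) !big_mkord sz_s.
  rewrite -scaler_prod; apply: eq_bigr => i _.
  have z_neq0 := s_neq0 _ (mem_s i).
  by rewrite /r scalerBr !scaleNr opprK scalerA mulfV // scale1r [RHS]addrC alg_polyC.
have /eqpf_eq[d d_neq0 pd] : p %= pole_prod predT r.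
  apply: (eqp_trans p_eq); rewrite prod_eq eqp_scale //.
  by rewrite prodf_seq_neq0; apply/allP => z /s_neq0; rewrite oppr_eq0.
(* Both polynomials take the value 1 at 0, so the scalar d is 1. *)
have := p_at0 N a b; rewrite -/p pd hornerZ.
rewrite horner_prod big1 ?mulr1 => [->|i _]; first by rewrite scale1r.
by rewrite !hornerE ?mulr0 ?subr0.
Qed.

End Trinomial.

(** * Descent from the splitting field *)

Section HadamardSquare.
Set Implicit Arguments.
Unset Strict Implicit.
Variable F : fieldType.
Variables (N : nat) (a b : F).
Hypotheses (N_gt0 : (0 < N)%N) (a_neq0 : a != 0) (b_neq0 : b != 0).
Hypothesis two_neq0 : 2 != 0 :> F.
Hypothesis disc_neq0 : N.+1%:R ^+ N.+1 * b + N%:R ^+ N * a ^+ N.+1 != 0.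

Let p := p_ N.+1 a b.
Let g := fps_inv (fps_of_poly p).
Let rhs := p * (p \Po (- 'X)) * (f_ N a (- b) \Po 'X^2).

Variables H1 H2 : {poly F}.
Hypothesis H12 : fps_is_ratio (hadamard g g) H1 H2.
Hypothesis co_H : coprimep H1 H2.

(** The roots live in an extension L, but neither side mentions them, and a field embedding
    preserves and reflects [%=]. *)
Lemma hadamard_square_eqp : H2 \Po 'X^2 %= rhs.
Proof.
have p0 : p.[0] = 1 by apply: p_at0.
have p_neq0 : p != 0.
  by apply: contra_eq_neq p0 => ->; rewrite horner0 eq_sym oner_neq0.
have [L [h [s p_split]]] := splitting_field p_neq0.
have disc : N.+1%:R ^+ N.+1 * h b + N%:R ^+ N * h a ^+ N.+1 != 0.
  have := disc_neq0; rewrite -(fmorph_eq0 h).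
  by rewrite rmorphD !rmorphM !rmorphXn !rmorph_nat.
rewrite map_p in p_split.
have hb : h b != 0 by rewrite fmorph_eq0.
have ha : h a != 0 by rewrite fmorph_eq0.
have h2 : 2 != 0 :> L by rewrite -(rmorph_nat h) fmorph_eq0.
have [r [r_inj r_root p_prod]] := split_trinomial N_gt0 hb disc p_split.
rewrite -(eqp_map h) /rhs !rmorphM /= !map_comp_poly map_polyXn rmorphN /= map_polyX.
rewrite map_p map_f rmorphN.
apply: (@hadamard_denominator _ _ _ _ ha hb h2 N_gt0 r r_inj r_root p_prod
  (h \o g) (map_poly h H1)); last by rewrite coprimep_map.
  move=> m; rewrite -map_p.
  have p0' : fps_of_poly p 0%N != 0.
    by rewrite /fps_of_poly -horner_coef0 p0 oner_neq0.
  have := congr1 h (fps_mulV p0' m); rewrite rmorph_nat => <-.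
  rewrite rmorph_sum; apply: eq_bigr => i _.
  by rewrite rmorphM /fps_of_poly coef_map.
case: H12 => _ H12' m; rewrite /fps_of_poly coef_map.
rewrite -[H1`_m]/(fps_of_poly H1 m) -H12' /fps_mul /= (rmorph_sum h).
by apply: eq_bigr => i _; rewrite !rmorphM /fps_of_poly coef_map.
Qed.

Lemma hadamard_square_eq : H2.[0] = 1 -> H2 \Po 'X^2 = rhs.
Proof.
move=> H20; have /eqpf_eq[c _ Hc] := hadamard_square_eqp.
have p0 : p.[0] = 1 by apply: p_at0.
have := congr1 (fun q : {poly F} => q.[0]) Hc.
rewrite hornerZ /rhs !hornerM !horner_comp hornerN hornerX hornerXn expr0n oppr0.
by rewrite p0 f_at0 H20 !mulr1 Hc => <-; rewrite scale1r.
Qed.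

End HadamardSquare.

(** * Nonvanishing in Q(a, b), and the theorem *)

Section IndependenceQab.
Set Implicit Arguments.

Lemma Qab_neq0 (P : {mpoly rat[2]}) (v : 'I_2 -> rat) :
  P.@[v] != 0 -> (FracField.tofrac P : Qab) != 0.
Proof.
rewrite tofrac_eq0; apply: contra_neq => ->.
by rewrite meval0.
Qed.

Lemma Qab_nat_neq0 n : (0 < n)%N -> n%:R != 0 :> Qab.
Proof.
move=> n_gt0; rewrite -(rmorph_nat (@FracField.tofrac _)).
apply: (@Qab_neq0 _ (fun => 0)); rewrite rmorph_nat Num.Theory.pnatr_eq0; lia.
Qed.

Lemma a_neq0 : a_ != 0.
Proof. by apply: (@Qab_neq0 _ (fun => 1)); rewrite mevalXU oner_neq0. Qed.

Lemma b_neq0 : b_ != 0.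
Proof. by apply: (@Qab_neq0 _ (fun => 1)); rewrite mevalXU oner_neq0. Qed.

Lemma Qab_disc_neq0 N :
  N.+1%:R ^+ N.+1 * b_ + N%:R ^+ N * a_ ^+ N.+1 != 0.
Proof.
pose P : {mpoly rat[2]} := N.+1%:R ^+ N.+1 * 'X_ord_max + N%:R ^+ N * 'X_ord0 ^+ N.+1.
have -> : N.+1%:R ^+ N.+1 * b_ + N%:R ^+ N * a_ ^+ N.+1 = FracField.tofrac P.
  by rewrite rmorphD !rmorphM !rmorphXn !rmorph_nat.
(* The point a = 0, b = 1 leaves (N + 1)^(N + 1). *)
apply: (@Qab_neq0 _ (fun i => (i == ord_max)%:R)).
rewrite mevalD !mevalM !rmorphXn /= !rmorph_nat !mevalXU /= expr0n mulr0 addr0 mulr1.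
by rewrite expf_neq0 // Num.Theory.pnatr_eq0.
Qed.

End IndependenceQab.

Theorem theorem4p19 (k : nat) (hk : (2 <= k)%N) (H1 H2 : {poly Qab}) :
  let p := p_ k a_ b_ in
  let f := f_ k.-1 a_ (- b_) in
  let g := fps_inv (fps_of_poly p) in
  fps_is_ratio (hadamard g g) H1 H2 ->
  coprimep H1 H2 ->
  (* In Q(a, b)[y] with y = sqrt x, i.e. x = y ^ 2: equality up to a unit of
     Q(a, b), and on the nose for the denominator with constant term 1. *)
  let rhs := p * (p \Po (- 'X)) * (f \Po 'X^2) in
  H2 \Po 'X^2 %= rhs /\ (H2.[0] = 1 -> H2 \Po 'X^2 = rhs).
Proof.
case: k hk => // N; rewrite ltnS => N_gt0 p f g ratio_H co_H rhs.
have two_neq0 := @Qab_nat_neq0 2 isT; have disc_neq0 := Qab_disc_neq0 N.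
split.
  exact: (hadamard_square_eqp N_gt0 a_neq0 b_neq0 two_neq0 disc_neq0 ratio_H co_H).
exact: (hadamard_square_eq N_gt0 a_neq0 b_neq0 two_neq0 disc_neq0 ratio_H co_H).
Qed.
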